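(* Let $p$ be a prime and let $n\ge 2$ and $s\ge 1$ be integers. The number of $n\times n$ matrices $A$ over $\mathbb{Z}_{p^s}$ such that $Ax\equiv 0\pmod{p^s}$ has at most $p^s$ solutions satisfies \[ \sum_{j=0}^{s}E(n\times n,p^s,p^j)=p^{sn^2}\bigl(1-p^{-s-3}+\mathcal{O}(p^{-s-4})\bigr). \] Equivalently, if the entries of $A$ are chosen independently and uniformly from $\mathbb{Z}_{p^s}$, the probability that the number $\eta$ of solutions of $Ax\equiv0\pmod{p^s}$ in $\mathbb{Z}_{p^s}^n$ is at most $p^s$ is $\mathbb{P}(\eta\le p^s)=1-p^{-s-3}+\mathcal{O}(p^{-s-4})$.
   Context: $\mathbb{Z}_{p^s}$ denotes the ring of integers modulo $p^s$. $E(n\times n,p^s,p^j)$ is the number of $n\times n$ matrices $A$ with entries in $\mathbb{Z}_{p^s}$ such that $Ax\equiv 0\pmod{p^s}$ has exactly $p^j$ solutions $x\in\mathbb{Z}_{p^s}^n$. $\mathcal{O}(p^{-s-4})$ denotes a quantity bounded in absolute value by a constant times $p^{-s-4}$ as $p\to\infty$. *)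

(* Defs.v *)
From HB Require Import structures.
From mathcomp Require Import all_boot all_order all_algebra.
From mathcomp Require Import all_classical all_reals all_analysis.

Set Implicit Arguments.
Unset Strict Implicit.
Unset Printing Implicit Defensive.

Import Order.TTheory GRing.Theory Num.Theory.
Import numFieldNormedType.Exports.

Local Open Scope ring_scope.

(** ['Z_q] is the ring of integers modulo [q] only for [1 < q]; below [q] is
    always instantiated with [p ^ s] for [p] prime and [1 <= s]. *)
Definition num_sol (n q : nat) (A : 'M['Z_q]_n) : nat :=
  #|[pred x : 'cV['Z_q]_n | A *m x == 0]|.

Definition num_mx_sol (n q k : nat) : nat :=
  #|[pred A : 'M['Z_q]_n | num_sol A == k]|.

Definition unif_mass (R : realType) (T : finType) (x : T) : R := #|T|%:R^-1.

(** The joint law of [n * n] independent entries, each uniform on ['Z_q]: the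
    mass of a matrix is the product of the masses of its entries. *)
Definition entries_law (R : realType) (n q : nat) (A : 'M['Z_q]_n) : R :=
  \prod_(i < n) \prod_(j < n) unif_mass R (A i j).

Definition prob_mx (R : realType) (n q : nat) (P : pred 'M['Z_q]_n) : R :=
  \sum_(A : 'M['Z_q]_n | P A) entries_law R A.

(** [p --> +oo] along the primes. *)
Definition primes_oo : set_system nat :=
  within (fun p : nat => is_true (prime p)) \oo%classic.

Global Instance primes_oo_filter : ProperFilter primes_oo.
Proof.
split; last exact: within_filter.
by move=> [N _ NP]; have [p Np pp] := prime_above N; apply: (NP p) => //=; exact: ltnW.
Qed.

(* Main.v *)
Require Import Defs.
From HB Require Import structures.
From mathcomp Require Import all_boot all_order all_algebra all_fingroup.
From mathcomp Require Import all_classical all_reals all_analysis.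
From mathcomp Require Import zify ring lra.

(** Write [q = p ^ s], [K] for the kernel of [A], and [W = p ^ (s n^2)] for the number
    of matrices; the size of [K] is a power of [p].

    Upper bound for the number of [A] with [|K| > p ^ s]. Let [p ^ a] be the exponent
    of [K], so [1 <= a <= s]. Count the pairs [(x, y)] in [K] with [x] of order [p ^ a]
    and [y <> 0] vanishing at a coordinate where [x] has order [p ^ a]. Each [A] has at
    least [p ^ s (p - 1) (p ^ (s + 1 - a) - 1)] of them. Conversely there are at most
    [p ^ (a n) * p ^ (b (n - 1))] such pairs with [y] of order [p ^ b], and each is killed
    by at most [W / p ^ ((a + b) n)] matrices. Summing the two geometric series, over [b]
    and then over [a], gives at most [p W / (p ^ s (p - 1) ^ 4)] matrices.

    Lower bound. The matrices with an invertible [(n - 2) x (n - 2)] block whose Schur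
    complement is [p u [[1, x], [y, x y]]], with [u] a unit mod [p ^ (s - 1)], have at
    least [p ^ (s + 1)] solutions, and there are at least [(1 - 2 / p) W / p ^ (s + 3)] of
    them. *)

Set Implicit Arguments.
Unset Strict Implicit.
Unset Printing Implicit Defensive.

Import Order.TTheory GRing.Theory Num.Theory.
Import numFieldNormedType.Exports.

Local Open Scope ring_scope.

(** * Torsion in ['Z_(p ^ s)] and in its column vectors *)

Lemma gt1_pexp (p s : nat) : prime p -> (0 < s)%N -> (1 < p ^ s)%N.
Proof. by move=> pp s0; rewrite -(exp1n s) ltn_exp2r // prime_gt1. Qed.

Lemma card_Zpexp (p s : nat) : prime p -> (0 < s)%N -> #|'Z_(p ^ s)| = (p ^ s)%N.
Proof. by move=> pp s0; rewrite card_ord Zp_cast // gt1_pexp. Qed.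

Lemma mulrn_pexp (p s m n : nat) : prime p -> (0 < s)%N ->
  forall x : 'M['Z_(p ^ s)]_(m, n), x *+ p ^ s = 0.
Proof.
move=> pp s0 x; apply/matrixP => i j; rewrite mulmxnE mxE -mulr_natr.
by rewrite pchar_Zp ?mulr0 // gt1_pexp.
Qed.

(** If [v] is the p-adic valuation of [z], then [v + a < s], so [p ^ s] can divide [z * (l - k)]
    only if [p ^ a.+1] divides [l - k]. *)
Lemma mulrn_eq_mod (p s a k l : nat) (z : 'Z_(p ^ s)) :
  prime p -> (0 < s)%N -> z *+ p ^ a != 0 -> z *+ k = z *+ l -> k = l %[mod p ^ a.+1].
Proof.
move=> pp s0; have q1 := gt1_pexp pp s0.
wlog lekl : k l / (k <= l)%N => [hw|] za ekl.
  by case/orP: (leq_total k l) => h; [exact: hw|apply/esym; exact: hw].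
have zE n : (z *+ n == 0) = (p ^ s %| z * n)%N.
  by rewrite -mulr_natr -{1}[z]natr_Zp -natrM -val_eqE /= val_Zp_nat //.
have zkl : z *+ (l - k) == 0 by rewrite mulrnBr // ekl subrr.
move: za zkl; rewrite !zE => za zkl.
apply/eqP; rewrite eq_sym eqn_mod_dvd //.
have [->|lk0] := posnP (l - k); first exact: dvdn0.
have z0 : (0 < z)%N by rewrite lt0n; apply: contra za => /eqP->.
have pa0 : (0 < p ^ a)%N by rewrite expn_gt0 prime_gt0.
by move: za zkl; rewrite !pfactor_dvdn ?muln_gt0 ?z0 // !lognM // pfactorK //; lia.
Qed.

Lemma mulrn_inj_lt (p s a k l : nat) (z : 'Z_(p ^ s)) :
  prime p -> (0 < s)%N -> z *+ p ^ a != 0 -> (k < p ^ a.+1)%N -> (l < p ^ a.+1)%N ->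
  z *+ k = z *+ l -> k = l.
Proof. by move=> pp s0 za ka la /(mulrn_eq_mod pp s0 za); rewrite !modn_small. Qed.

Lemma leq_card_muln (T U V : finType) (A : {pred T}) (f : T -> U -> V) :
  (forall x x' u u', x \in A -> x' \in A -> f x u = f x' u' -> x = x' /\ u = u') ->
  (#|A| * #|U| <= #|V|)%N.
Proof.
move=> fI; rewrite -cardX.
apply: (@leq_card_in _ _ (fun w => f w.1 w.2)) => -[x u] [x' u'].
by rewrite !inE /= !andbT => xA xA' /(fI _ _ _ _ xA xA')[-> ->].
Qed.

(** For [a < s], the translates of the torsion by the residues below [p ^ (s - a)] are disjoint:
    multiplying by [p ^ a] kills the torsion and keeps these residues apart. *)
Lemma card_torsion (p s a : nat) : prime p -> (0 < s)%N ->
  (#|[pred z : 'Z_(p ^ s) | z *+ p ^ a == 0%R]| <= p ^ a)%N.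
Proof.
move=> pp s0; have [sa|/ltnW las] := leqP s a.
  by rewrite (leq_trans (max_card _)) // card_Zpexp // leq_pexp2l // prime_gt0.
have h1 : (1 : 'Z_(p ^ s)) *+ p ^ s.-1 != 0.
  rewrite -val_eqE /= val_Zp_nat ?gt1_pexp // modn_small -?lt0n ?expn_gt0 ?prime_gt0 //.
  by rewrite ltn_exp2l ?prime_gt1 // prednK.
rewrite -(@leq_pmul2r (p ^ (s - a))) ?expn_gt0 ?prime_gt0 //.
rewrite -expnD subnKC //.
suff : (#|[pred z : 'Z_(p ^ s) | (z *+ p ^ a)%R == 0%R]| * #|'I_(p ^ (s - a))|
        <= #|'Z_(p ^ s)|)%N by rewrite card_Zpexp // card_ord.
apply: (@leq_card_muln _ _ _ _ (fun z (k : 'I_(p ^ (s - a))) => z + k%:R)) => z t k l.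
rewrite !inE => /eqP zt /eqP tt e.
have ekl : (1 : 'Z_(p ^ s)) *+ (p ^ a * k) = 1 *+ (p ^ a * l).
  by rewrite !(mulnC (p ^ a)%N) !mulrnA -[LHS]add0r -zt -mulrnDl e mulrnDl tt add0r.
have eqkl : k = l.
  apply/val_inj/eqP; rewrite -(@eqn_pmul2l (p ^ a)%N) ?expn_gt0 ?prime_gt0 //.
  have lt (i : 'I_(p ^ (s - a))) : (p ^ a * i < p ^ s.-1.+1)%N.
    rewrite prednK // -[X in (_ < p ^ X)%N](subnKC las) expnD.
    by rewrite ltn_pmul2l // expn_gt0 prime_gt0.
  by rewrite (mulrn_inj_lt pp s0 h1 _ _ ekl).
by split=> //; rewrite -eqkl in e; exact: addIr e.
Qed.

Lemma card_cV_forall (T : finType) (n : nat) (P : 'I_n -> pred T) :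
  #|[pred x : 'cV[T]_n | [forall i, P i (x i 0)]]| = (\prod_i #|P i|)%N.
Proof.
transitivity #|family P|; last by rewrite card_family foldrE big_map big_enum.
pose f (g : {ffun 'I_n -> T}) : 'cV[T]_n := \col_i g i.
have fI : injective f.
  by move=> g h e; apply/ffunP => i; move/matrixP: e => /(_ i 0); rewrite !mxE.
rewrite -(fintype.card_image fI); apply: eq_card => x; rewrite !inE.
apply/forallP/fintype.imageP => [h|[g /familyP gP -> i]]; last by rewrite mxE; exact: gP.
exists [ffun i => x i 0]; first by apply/familyP => i; rewrite ffunE; exact: h.
by apply/matrixP => i j; rewrite mxE ffunE ord1.
Qed.

Lemma card_torsion_cV (p s a n : nat) : prime p -> (0 < s)%N ->
  (#|[pred x : 'cV['Z_(p ^ s)]_n | (x *+ p ^ a)%R == 0%R]| <= p ^ (a * n))%N.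
Proof.
move=> pp s0; set A := [pred x | _].
have -> : #|A| = (\prod_(i < n) #|[pred z : 'Z_(p ^ s) | (z *+ p ^ a)%R == 0%R]|)%N.
  rewrite -(card_cV_forall (fun=> _)); apply: eq_card => x; rewrite !inE.
  apply/eqP/forallP => [h i|h] /=; first by rewrite -mulmxnE h mxE.
  by apply/matrixP => i j; rewrite mulmxnE mxE ord1; apply/eqP/h.
rewrite expnM -[X in (_ <= _ ^ X)%N]card_ord -prod_nat_const.
by apply: leq_prod => i _; exact: card_torsion.
Qed.

(** Coordinate [i] has one choice instead of up to [p ^ a]. This saved factor later makes the sum
    over the orders of [y] geometric. *)
Lemma card_torsion_cV_eq0 (p s a n : nat) (i : 'I_n) : prime p -> (0 < s)%N ->
  (#|[pred x : 'cV['Z_(p ^ s)]_n | ((x *+ p ^ a)%R == 0%R) && (x i 0%R == 0%R)]| * p ^ a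
     <= p ^ (a * n))%N.
Proof.
move=> pp s0; set A := [pred x | _].
have -> : #|A| = (\prod_(j < n) #|[pred z : 'Z_(p ^ s) |
    ((z *+ p ^ a)%R == 0%R) && ((j == i) ==> (z == 0%R))]|)%N.
  rewrite -(card_cV_forall (fun j : 'I_n => [pred z | _ & (j == i) ==> _])).
  apply: eq_card => x; rewrite !inE.
  apply/andP/forallP => [[/eqP h xi] j|h] /=.
    by rewrite -mulmxnE h mxE eqxx; apply/implyP => /eqP->.
  split; last by have /andP[_] := h i; rewrite eqxx.
  by apply/eqP/matrixP => j k; rewrite mulmxnE mxE ord1; apply/eqP; case/andP: (h j).
rewrite (bigD1 i) //= (@fintype.eq_card1 _ 0) ?mul1n; last first.
  by move=> z; rewrite !inE eqxx /=; apply: andb_idl => /eqP->; rewrite mul0rn.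
rewrite expnM -[X in (_ <= _ ^ X)%N]card_ord -prod_nat_const [leqRHS](bigD1 i) //= mulnC.
rewrite leq_mul2l; apply/orP; right; apply: leq_prod => j _.
apply: leq_trans (card_torsion a pp s0); apply: subset_leq_card.
by apply/fintype.subsetP => z; rewrite !inE => /andP[].
Qed.

(** * Matrices that kill one or two given columns *)

Lemma mulmx_delta_col (R : pzRingType) (m n : nat) (k : 'cV[R]_m) (i : 'I_n) (x : 'cV[R]_n) :
  (k *m delta_mx 0 i : 'M[R]_(m, n)) *m x = k *m (x i 0)%:M.
Proof.
rewrite -mulmxA; congr (_ *m _); apply/matrixP => u v.
rewrite !mxE !ord1 eqxx mulr1n (bigD1 i) //= big1 ?addr0 ?mxE ?eqxx ?mul1r //.
by move=> j ji; rewrite mxE eqxx (negPf ji) mul0r.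
Qed.

Lemma natr_col_inj (p s a m : nat) (z : 'Z_(p ^ s)) (k l : {ffun 'I_m -> 'I_(p ^ a.+1)}) :
  prime p -> (0 < s)%N -> z *+ p ^ a != 0 ->
  (\col_i (k i)%:R) *m z%:M = (\col_i (l i)%:R) *m z%:M -> k = l.
Proof.
move=> pp s0 za e; apply/ffunP => i; apply/val_inj.
apply: (mulrn_inj_lt pp s0 za (ltn_ord _) (ltn_ord _)).
by move/matrixP: e => /(_ i 0); rewrite !mul_mx_scalar !mxE !mulr_natr.
Qed.

(** The translates of the matrices killing [x] by [k e_i], with [k] a column of residues
    mod [p ^ a.+1] and [i] a coordinate where [x] has at least that order, are disjoint. *)
Lemma card_kill1 (p s a m n : nat) (x : 'cV['Z_(p ^ s)]_n) :
  prime p -> (0 < s)%N -> x *+ p ^ a != 0 ->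
  (#|[pred A : 'M['Z_(p ^ s)]_(m, n) | A *m x == 0%R]| * p ^ (a.+1 * m)
     <= #|{: 'M['Z_(p ^ s)]_(m, n)}|)%N.
Proof.
move=> pp s0 xa.
have [i xi] : exists i, x i 0 *+ p ^ a != 0.
  apply/existsP; apply: contraR xa; rewrite negb_exists => /forallP h.
  apply/eqP/matrixP => i j; rewrite mulmxnE mxE ord1; apply/eqP.
  by have := h i; rewrite negbK.
rewrite expnM -[X in (_ * X ^ _ <= _)%N]card_ord -[X in (_ * _ ^ X)%N]card_ord -card_ffun.
apply: (@leq_card_muln _ _ _ _ (fun A (k : {ffun 'I_m -> 'I_(p ^ a.+1)}) =>
   A + (\col_i (k i)%:R) *m delta_mx 0 i)) => A A' k k'.
rewrite !inE => /eqP Ax /eqP A'x e.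
have ekk : k = k'.
  apply: (natr_col_inj pp s0 xi); have := congr1 (mulmx^~ x) e.
  by rewrite !mulmxDl Ax A'x !add0r !mulmx_delta_col.
by split=> //; rewrite -ekk in e; exact: addIr e.
Qed.

(** Matrices are translated by [k] in column [i] and by [l] in a column [j] where [y] has large
    order. Since [y i 0 = 0], evaluating at [y] ignores [k] and recovers [l]; evaluating at [x] then
    recovers [k]. *)
Lemma card_kill2 (p s a b m n : nat) (i : 'I_n) (x y : 'cV['Z_(p ^ s)]_n) :
  prime p -> (0 < s)%N -> x i 0 *+ p ^ a != 0 -> y i 0 = 0 -> y *+ p ^ b != 0 ->
  (#|[pred A : 'M['Z_(p ^ s)]_(m, n) | (A *m x == 0%R) && (A *m y == 0%R)]|
     * p ^ ((a.+1 + b.+1) * m) <= #|{: 'M['Z_(p ^ s)]_(m, n)}|)%N.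
Proof.
move=> pp s0 xi yi yb.
have [j yj] : exists j, y j 0 *+ p ^ b != 0.
  apply/existsP; apply: contraR yb; rewrite negb_exists => /forallP h.
  apply/eqP/matrixP => j k; rewrite mulmxnE mxE ord1; apply/eqP.
  by have := h j; rewrite negbK.
pose T c := {ffun 'I_m -> 'I_(p ^ c)}.
have cT c : (p ^ (c * m))%N = #|{: T c}| by rewrite card_ffun !card_ord expnM.
rewrite mulnDl expnD !cT -card_prod.
apply: (@leq_card_muln _ _ _ _ (fun A (w : T a.+1 * T b.+1) =>
   A + (\col_i (w.1 i)%:R) *m delta_mx 0 i + (\col_i (w.2 i)%:R) *m delta_mx 0 j)).
move=> A A' [k l] [k' l']; rewrite !inE /= => /andP[/eqP Ax /eqP Ay] /andP[/eqP A'x /eqP A'y] e.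
have ell : l = l'.
  apply: (natr_col_inj pp s0 yj); have := congr1 (mulmx^~ y) e.
  by rewrite !mulmxDl Ay A'y !add0r !mulmx_delta_col yi !mul_mx_scalar !scale0r !add0r.
rewrite -ell in e *; move/addIr: e => e.
have ekk : k = k'.
  apply: (natr_col_inj pp s0 xi); have := congr1 (mulmx^~ x) e.
  by rewrite !mulmxDl Ax A'x !add0r !mulmx_delta_col.
by rewrite -ekk in e *; split=> //; exact: addIr e.
Qed.

(** * Subgroups of p-groups, fibres and geometric sums *)

(** In a finite group, containing 0 and being closed under addition suffices for a subgroup, so
    Lagrange applies. *)
Lemma card_zmod_pred (p k : nat) (V : finZmodType) (P : pred V) : prime p ->
  #|V| = (p ^ k)%N -> P 0 -> (forall x y, P x -> P y -> P (x + y)) ->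
  exists2 j, (j <= k)%N & #|P| = (p ^ j)%N.
Proof.
move=> pp cV P0 PD.
have gG : group_set [set x | P x]%SET.
  apply/group_setP; split=> [|x y]; first by rewrite inE FinRing.zmod1gE.
  by rewrite !inE FinRing.zmodMgE; exact: PD.
have := cardSg (finset.subsetT (Group gG)); rewrite finset.cardsT cV /= finset.cardsE.
by move/(dvdn_pfactor _ _ pp).
Qed.

Lemma card_additive_fiber (V W : finZmodType) (P : pred V) (f : V -> W) (Q : pred W) :
  {morph f : x y / x + y} -> (forall x y, P x -> P y -> P (x - y)) ->
  (forall x, P x -> Q (f x)) ->
  (#|P| <= #|Q| * #|[pred x | P x & f x == 0%R]|)%N.
Proof.
move=> fD PB PQ.
have fB x y : f (x - y) = f x - f y.
  by apply: (addIr (f y)); rewrite -fD !subrK.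
rewrite -sum1_card (partition_big f Q) //= -sum_nat_const.
apply: leq_sum => c _; rewrite sum1dep_card finset.cardsE.
have [x /andP[Px /eqP fx]|h] := pickP (fun x => P x && (f x == c)); last first.
  by rewrite (fintype.eq_card0 h).
rewrite -(fintype.card_image (@subIr _ x)); apply: subset_leq_card.
apply/fintype.subsetP => z /fintype.imageP[y]; rewrite !inE => /andP[Py /eqP fy] ->.
by rewrite PB //= fB fx fy subrr.
Qed.

Lemma geometric_bound (p W s : nat) (N : nat -> nat) : (0 < p)%N ->
  (forall b, (b < s)%N -> (N b * p ^ b.+1 <= W)%N) ->
  (p.-1 * \sum_(b < s) N b <= W)%N.
Proof.
move=> p0 NW; rewrite -(@leq_pmul2r (p ^ s)) ?expn_gt0 ?p0 //.
(* The induction carries this sharper bound, the exact value of the finite geometric sum. *)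
apply: (@leq_trans (W * (p ^ s).-1)); last by rewrite leq_mul2l leq_pred orbT.
elim: s NW => [|s IHs] NW; first by rewrite big_ord0 muln0.
have {}IHs := IHs (fun b bs => NW b (ltnW bs)).
have NWs := NW s (ltnSn s).
clear NW.
have ps : (0 < p ^ s)%N by rewrite expn_gt0 p0.
rewrite big_ord_recr /=; move: (\sum_(_ < _) _)%N IHs NWs => S IHs NWs.
rewrite expnS in NWs *; move: (p ^ s)%N ps (N s) IHs NWs => q q0 t IHs NWs.
case: p p0 NWs IHs => // p _ /= NWs IHs; case: q q0 NWs IHs => // q _ /= NWs IHs.
nia.
Qed.

(** * Upper bound: sizes of kernels and independent pairs in them *)

Lemma card_mx_Zpexp (p s m n : nat) : prime p -> (0 < s)%N ->
  #|{: 'M['Z_(p ^ s)]_(m, n)}| = (p ^ (s * (m * n)))%N.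
Proof. by move=> pp s0; rewrite card_mx card_Zpexp // -expnM. Qed.

Lemma num_sol_pexp (p s n : nat) (A : 'M['Z_(p ^ s)]_n) : prime p -> (0 < s)%N ->
  exists j, num_sol A = (p ^ j)%N.
Proof.
move=> pp s0.
have [j _ e] := @card_zmod_pred _ _ _ (fun x : 'cV_n => A *m x == 0) pp
  (card_mx_Zpexp n 1 pp s0) (introT eqP (mulmx0 _ A))
  (fun x y hx hy => introT eqP (etrans (mulmxDr A x y)
     (etrans (congr2 +%R (eqP hx) (eqP hy)) (addr0 0)))).
by exists j; rewrite -e.
Qed.

(** For [k = p ^ a] and [x] killed by [p ^ a.+1], this makes the cyclic groups generated
    by [x] and [y] meet trivially. *)
Definition pivot_free (q n k : nat) (x y : 'cV['Z_q]_n) : bool :=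
  if [pick i | x i 0 *+ k != 0] is Some i then y i 0 == 0 else false.

(** The exponents are shifted so that [a = 0] and [b = 0] mean order [p]. [pivot_free] forces
    [w.1 *+ p ^ a] to be nonzero, so both orders are exact. *)
Definition split_pair (p s n a b : nat) (w : 'cV['Z_(p ^ s)]_n * 'cV['Z_(p ^ s)]_n) : bool :=
  [&& w.1 *+ p ^ a.+1 == 0, pivot_free (p ^ a) w.1 w.2,
      w.2 *+ p ^ b.+1 == 0 & w.2 *+ p ^ b != 0].

Lemma card_split_pair (p s n a b : nat) : prime p -> (0 < s)%N ->
  (#|[pred w | @split_pair p s n a b w]| * p ^ b.+1 <= p ^ ((a.+1 + b.+1) * n))%N.
Proof.
move=> pp s0.
rewrite -sum1_card (eq_bigl (fun w => true && split_pair a b (w.1, w.2))); last by case.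
rewrite -(pair_big_dep xpredT (fun x y => split_pair a b (x, y)) (fun _ _ => 1%N)) /=.
rewrite mulnDl expnD.
apply: (@leq_trans (#|[pred x : 'cV['Z_(p ^ s)]_n | (x *+ p ^ a.+1)%R == 0%R]|
                     * p ^ (b.+1 * n))); last first.
  by rewrite leq_mul2r card_torsion_cV ?orbT.
rewrite -sum_nat_const big_distrl /= [leqRHS]big_mkcond; apply: leq_sum => x _.
rewrite sum1dep_card finset.cardsE inE.
rewrite /split_pair /= /pivot_free; case: eqP => _ /=; last by rewrite fintype.eq_card0.
case: pickP => [i _|_] /=; last by rewrite fintype.eq_card0.
apply: leq_trans (card_torsion_cV_eq0 b.+1 i pp s0); rewrite leq_mul2r.
apply/orP; right; apply: subset_leq_card; apply/fintype.subsetP => y.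
by rewrite !inE => /and3P[-> -> _].
Qed.

(** The loss per pair in [card_kill2] cancels the main factor in the number of pairs, leaving the
    factor [p ^ b.+1] saved by the vanishing coordinate. *)
Lemma sum_kill_split_pair (p s n a b : nat) : prime p -> (0 < s)%N ->
  ((\sum_(w | @split_pair p s n a b w)
     #|[pred A : 'M['Z_(p ^ s)]_n | (A *m w.1 == 0%R) && (A *m w.2 == 0%R)]|) * p ^ b.+1
     <= #|{: 'M['Z_(p ^ s)]_n}|)%N.
Proof.
move=> pp s0; set W := #|{: 'M['Z_(p ^ s)]_n}|; set S := (\sum_(w | _) _)%N.
have e0 : (0 < p ^ ((a.+1 + b.+1) * n))%N by rewrite expn_gt0 prime_gt0.
have SW : (S * p ^ ((a.+1 + b.+1) * n) <= #|[pred w | @split_pair p s n a b w]| * W)%N.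
  rewrite -sum_nat_const big_distrl /=; apply: leq_sum => -[x y].
  rewrite /split_pair /pivot_free /=; case: pickP => [i xi|_]; last by rewrite andbF.
  by case/and4P => _ /eqP yi _ yb; apply: (card_kill2 _ pp s0 xi yi yb).
rewrite -(leq_pmul2r e0) mulnAC; apply: leq_trans (leq_mul SW (leqnn _)) _.
by rewrite mulnAC mulnC leq_mul2l card_split_pair ?orbT.
Qed.

Lemma pexp_diff_ge (p u v w X : nat) : (0 < p)%N -> (u <= v)%N -> (w <= v)%N ->
  (u + X = p * v)%N -> (w * p.-1 <= X)%N.
Proof. by case: p => // p _ /= uv wv e; nia. Qed.

(** The kernel has at least [p ^ s.+1] elements, and [x0] shows that its [p ^ a]-torsion is a proper
    subgroup, hence at most a fraction [1 / p] of it. *)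
Lemma card_full_order (p s n a : nat) (A : 'M['Z_(p ^ s)]_n) (x0 : 'cV['Z_(p ^ s)]_n) :
  prime p -> (0 < s)%N -> (p ^ s < num_sol A)%N -> A *m x0 = 0 -> x0 *+ p ^ a != 0 ->
  (p ^ s * p.-1 <= #|[pred x : 'cV['Z_(p ^ s)]_n | (A *m x == 0%R) && ((x *+ p ^ a)%R != 0%R)]|)%N.
Proof.
move=> pp s0 sA Ax0 x0a.
pose K := fun x : 'cV['Z_(p ^ s)]_n => A *m x == 0.
pose T := fun x : 'cV['Z_(p ^ s)]_n => x *+ p ^ a == 0.
have [i _ cKT] : exists2 i, (i <= s * (n * 1))%N & #|[pred x | K x && T x]| = (p ^ i)%N.
  apply: (card_zmod_pred pp (card_mx_Zpexp n 1 pp s0)).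
    by rewrite /= /K /T mulmx0 mul0rn eqxx.
  move=> x y /andP[/eqP Kx /eqP Tx] /andP[/eqP Ky /eqP Ty] /=.
  by rewrite /K /T mulmxDr mulrnDl Kx Ky Tx Ty addr0 eqxx.
have [j cK] := num_sol_pexp A pp s0.
have := cardID T [pred x | K x]; rewrite -[X in (_ = X)%N]/(num_sol A) cK.
set X := #|predD _ _|; set Y := #|predI _ _|.
have -> : Y = (p ^ i)%N by rewrite -cKT; apply: eq_card => x; rewrite !inE.
have -> : #|[pred x : 'cV_n | A *m x == 0 & x *+ p ^ a != 0]| = X.
  by apply: eq_card => x; rewrite !inE andbC.
have X0 : (0 < X)%N.
  by apply/card_gt0P; exists x0; rewrite !inE /T /K x0a Ax0 eqxx.
move=> e.
have p1 := prime_gt1 pp.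
have ij : (i < j)%N by rewrite -(ltn_exp2l _ _ p1) -e -addn1 leq_add2l.
have sj : (s < j)%N by rewrite -(ltn_exp2l _ _ p1) -cK.
case: j => // j in ij sj e cK *; rewrite expnS in e.
by apply: pexp_diff_ge e; rewrite ?leq_exp2l ?prime_gt0.
Qed.
(** The [i]-th coordinate maps a kernel of size at least [p ^ s.+1] into the [p ^ a.+1]-torsion of
    the ring, so some fibre, hence the one over 0, is large. *)
Lemma card_coord_eq0 (p s n a : nat) (A : 'M['Z_(p ^ s)]_n) (i : 'I_n) :
  prime p -> (0 < s)%N -> (a < s)%N -> (p ^ s < num_sol A)%N ->
  (forall x : 'cV_n, A *m x = 0 -> x *+ p ^ a.+1 = 0) ->
  (p ^ (s - a) <= #|[pred y : 'cV['Z_(p ^ s)]_n | (A *m y == 0%R) && (y i 0%R == 0%R)]|)%N.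
Proof.
move=> pp s0 las sA KT; have p1 := prime_gt1 pp.
have pa0 : (0 < p ^ a.+1)%N by rewrite expn_gt0 prime_gt0.
rewrite -(leq_pmul2l pa0) -expnD addSn subnKC ?(ltnW las) //.
have [j cK] := num_sol_pexp A pp s0.
apply: (@leq_trans (num_sol A)).
  by move: sA; rewrite cK ltn_exp2l // leq_exp2l.
apply: leq_trans (leq_mul (card_torsion a.+1 pp s0) (leqnn _)).
apply: (@card_additive_fiber _ _ [pred x : 'cV_n | A *m x == 0] (fun x : 'cV_n => x i 0)).
- by move=> x y; rewrite mxE.
- by move=> x y /eqP Kx /eqP Ky /=; rewrite mulmxBr Kx Ky subr0.
- by move=> x /eqP Kx; rewrite inE -mulmxnE KT // mxE.
Qed.
Lemma card_pivot_pairs (p s n a : nat) (A : 'M['Z_(p ^ s)]_n) (x0 : 'cV['Z_(p ^ s)]_n) :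
  prime p -> (0 < s)%N -> (a < s)%N -> (p ^ s < num_sol A)%N ->
  (forall x : 'cV_n, A *m x = 0 -> x *+ p ^ a.+1 = 0) ->
  A *m x0 = 0 -> x0 *+ p ^ a != 0 ->
  (p ^ s * p.-1 * (p ^ (s - a)).-1 <=
   #|[pred w : 'cV['Z_(p ^ s)]_n * 'cV['Z_(p ^ s)]_n |
      [&& A *m w.1 == 0%R, A *m w.2 == 0%R, w.2 != 0%R & pivot_free (p ^ a) w.1 w.2]]|)%N.
Proof.
move=> pp s0 las sA KT Ax0 x0a.
pose Q (x y : 'cV['Z_(p ^ s)]_n) :=
  [&& A *m x == 0, A *m y == 0, y != 0 & pivot_free (p ^ a) x y].
rewrite -sum1_card (eq_bigl (fun w => true && Q w.1 w.2)) //.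
rewrite -(pair_big_dep xpredT Q (fun _ _ => 1%N)) /=.
apply: leq_trans (leq_mul (card_full_order pp s0 sA Ax0 x0a) (leqnn _)) _.
rewrite -sum_nat_const [leqLHS]big_mkcond; apply: leq_sum => x _.
rewrite /Q sum1dep_card finset.cardsE inE; case: eqP => //= Ax.
case: ifP => // xa; rewrite /pivot_free; case: pickP => [i xi|h]; last first.
  case/negP: xa; apply/eqP/matrixP => i k.
  by rewrite mulmxnE mxE ord1; apply/eqP; have := h i; case: eqP.
rewrite -ltnS prednK ?expn_gt0 ?prime_gt0 //.
apply: leq_trans (card_coord_eq0 i pp s0 las sA KT) _.
(* Discarding [y = 0] turns [p ^ (s - a)] into its predecessor. *)
rewrite [leqLHS](cardD1 0) !inE mulmx0 mxE !eqxx add1n ltnS.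
apply: subset_leq_card; apply/fintype.subsetP => y; rewrite !inE.
by case/and3P => y0 Ay yi; apply/and3P.
Qed.

Lemma exists_order (p s m n : nat) (x : 'M['Z_(p ^ s)]_(m, n)) : prime p -> (0 < s)%N ->
  x != 0 -> exists2 b, (b < s)%N & (x *+ p ^ b.+1 == 0) && (x *+ p ^ b != 0).
Proof.
move=> pp s0 x0; have ex : exists b, x *+ p ^ b == 0 by exists s; rewrite mulrn_pexp.
case: (ex_minnP ex) => -[|b] xb bmin; first by rewrite expn0 mulr1n (negPf x0) in xb.
exists b; first by apply: bmin; rewrite mulrn_pexp.
by rewrite xb /=; apply/negP => /bmin; rewrite ltnn.
Qed.

(** The last two conditions say that the kernel of [A] has exponent [p ^ a.+1]. *)
Definition large_ker (p s n a : nat) : pred 'M['Z_(p ^ s)]_n := fun A =>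
  [&& (p ^ s < num_sol A)%N,
      [forall x : 'cV_n, (A *m x == 0) ==> (x *+ p ^ a.+1 == 0)] &
      [exists x : 'cV_n, (A *m x == 0) && (x *+ p ^ a != 0)]].

Lemma large_ker_exponent (p s n : nat) (A : 'M['Z_(p ^ s)]_n) : prime p -> (0 < s)%N ->
  (p ^ s < num_sol A)%N -> exists2 a, (a < s)%N & large_ker a A.
Proof.
move=> pp s0 sA.
pose e a := [forall x : 'cV_n, (A *m x == 0) ==> (x *+ p ^ a == 0)].
have es : e s by apply/forallP => x; rewrite mulrn_pexp // eqxx implybT.
case: (ex_minnP (ex_intro e s es)) => -[|a] ea amin.
  (* Exponent 1 would make the kernel trivial, contradicting [sA]. *)
  have : (num_sol A <= 1)%N.
    rewrite -(card1 (0 : 'cV['Z_(p ^ s)]_n)); apply: subset_leq_card.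
    by apply/fintype.subsetP => x; rewrite !inE; move/forallP: ea => /(_ x)/implyP.
  by rewrite leqNgt (leq_ltn_trans _ sA) // expn_gt0 prime_gt0.
exists a; first exact: amin.
rewrite /large_ker sA -/(e a.+1) ea /=; apply/contraT.
rewrite negb_exists => /forallP h; have := amin a; rewrite ltnn => -> //.
by apply/forallP => x; rewrite -[_ ==> _]negbK negb_imply h.
Qed.

(** Double counting of matrices with a pair they kill: [card_pivot_pairs] bounds the count below for
    each matrix, and [sum_kill_split_pair], summed over [b], bounds it above by [W / (p - 1)]. *)
Lemma card_large_ker (p s n a : nat) : prime p -> (0 < s)%N -> (a < s)%N ->
  (#|@large_ker p s n a| * (p ^ s * p.-1 ^ 3) * p ^ (s - a.+1) <= #|{: 'M['Z_(p ^ s)]_n}|)%N.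
Proof.
move=> pp s0 las; set W := #|{: 'M['Z_(p ^ s)]_n}|.
pose k (A : 'M['Z_(p ^ s)]_n) (w : 'cV['Z_(p ^ s)]_n * 'cV['Z_(p ^ s)]_n) :=
  (A *m w.1 == 0) && (A *m w.2 == 0).
pose N b := (\sum_(w | @split_pair p s n a b w) #|[pred A | k A w]|)%N.
have NW : (p.-1 * \sum_(b < s) N b <= W)%N.
  apply: geometric_bound; first exact: prime_gt0.
  by move=> b _; exact: sum_kill_split_pair.
have EN : (#|@large_ker p s n a| * (p ^ s * p.-1 * (p ^ (s - a)).-1) <= \sum_(b < s) N b)%N.
  rewrite -sum_nat_const.
  apply: (@leq_trans (\sum_(A in @large_ker p s n a) \sum_(b < s)
            #|[pred w | split_pair a b w & k A w]|)%N).
    apply: leq_sum => A /and3P[sA /forallP KT /existsP[x0 /andP[/eqP Ax0 x0a]]].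
    have {}KT (x : 'cV_n) : A *m x = 0 -> x *+ p ^ a.+1 = 0.
      by move=> Ax; apply/eqP; move: (KT x); rewrite Ax eqxx.
    apply: leq_trans (card_pivot_pairs pp s0 las sA KT Ax0 x0a) _.
    set P := [pred w | _].
    apply: (@leq_trans (\sum_(w | P w) \sum_(b < s | split_pair a b w && k A w) 1)%N).
      rewrite -sum1_card; apply: leq_sum => w /and4P[/eqP Kx Ky y0 piv].
      have [b bs /andP[yb yb']] := exists_order pp s0 y0.
      rewrite (bigD1 (Ordinal bs)) //= /split_pair /k yb yb' piv Ky Kx eqxx.
      by rewrite KT // eqxx.
    rewrite (exchange_big_dep xpredT) //=; apply: leq_sum => b _.
    rewrite sum1dep_card; apply: subset_leq_card; apply/fintype.subsetP => w.
    by rewrite !inE => /andP[].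
  apply: (@leq_trans (\sum_A \sum_(b < s) #|[pred w | @split_pair p s n a b w & k A w]|)%N).
    by rewrite big_mkcond; apply: leq_sum => A _; case: ifP.
  rewrite exchange_big /=; apply: leq_sum => b _; rewrite /N.
  under eq_bigr do rewrite -sum1_card.
  rewrite (exchange_big_dep (fun w => split_pair a b w)) /=; last by move=> A w _ /andP[].
  by apply: leq_sum => w /= sw; rewrite -sum1_card; apply/eq_leq/eq_bigl => A; rewrite !inE sw.
have -> : (#|@large_ker p s n a| * (p ^ s * p.-1 ^ 3) * p ^ (s - a.+1) =
  p.-1 * (#|@large_ker p s n a| * (p ^ s * p.-1 * (p.-1 * p ^ (s - a.+1)))))%N.
  by rewrite !expnS expn0; lia.
apply: leq_trans NW; rewrite leq_mul2l; apply/orP; right; apply: leq_trans EN.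
rewrite !leq_mul2l; apply/orP; right; apply/orP; right.
(* The third factor [p.-1] comes from [p ^ (s - a) - 1 >= (p - 1) * p ^ (s - a.+1)]. *)
rewrite -[(s - a)%N]prednK ?subn_gt0 // -subnS expnS.
by rewrite -ltnS prednK ?muln_gt0 ?expn_gt0 ?prime_gt0 //; have := prime_gt0 pp;
  have : (0 < p ^ (s - a.+1))%N by [rewrite expn_gt0 prime_gt0]; nia.
Qed.

Lemma card_num_sol_gt_le (p s n : nat) : prime p -> (0 < s)%N ->
  (#|[pred A : 'M['Z_(p ^ s)]_n | (p ^ s < num_sol A)%N]| * (p ^ s * p.-1 ^ 4)
     <= p * #|{: 'M['Z_(p ^ s)]_n}|)%N.
Proof.
move=> pp s0; set W := #|{: 'M['Z_(p ^ s)]_n}|.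
(* With [c = s - a - 1] the terms decay like [1 / p ^ c]. Starting at [c = 0] costs the factor [p]
   on the right. *)
pose F c := (#|@large_ker p s n (s - c.+1)| * (p ^ s * p.-1 ^ 3))%N.
have FW : (p.-1 * \sum_(c < s) F c <= p * W)%N.
  apply: geometric_bound; first exact: prime_gt0.
  move=> c cs; rewrite expnS mulnCA leq_mul2l; apply/orP; right.
  have as' : (s - c.+1 < s)%N by lia.
  by have := card_large_ker n pp s0 as'; rewrite (_ : s - (s - c.+1).+1 = c)%N //; lia.
have EF : (#|[pred A : 'M['Z_(p ^ s)]_n | (p ^ s < num_sol A)%N]|
             <= \sum_(c < s) #|@large_ker p s n (s - c.+1)|)%N.
  rewrite -sum1_card.
  under [leqRHS]eq_bigr do rewrite -sum1_card big_mkcond.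
  rewrite exchange_big big_mkcond /=; apply: leq_sum => A _.
  case: ifP => // /(large_ker_exponent pp s0)[a las lA].
  have cs : (s - a.+1 < s)%N by lia.
  by rewrite (bigD1 (Ordinal cs)) //= (_ : (s - (s - a.+1).+1 = a)%N) 1?[_ \in _]lA //; lia.
apply: leq_trans FW; rewrite -big_distrl /=.
apply: leq_trans (leq_mul EF (leqnn _)) _; move: (\sum_(_ < _) _)%N => S.
by rewrite [(_ ^ 4)%N]expnS; lia.
Qed.

(** * Non-invertible matrices are rare *)

(** If [M] kills no nonzero column, left multiplication by [M] is injective on the finite set of
    square matrices, hence surjective, and [M] has an inverse. *)
Lemma nonunit_ker (p s m : nat) (M : 'M['Z_(p ^ s)]_m) :
  M \notin unitmx -> exists2 x : 'cV_m, x != 0 & M *m x = 0.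
Proof.
move=> Mu; have [x /andP[x0 /eqP Mx]|h] := pickP (fun x : 'cV_m => (x != 0) && (M *m x == 0)).
  by exists x.
case/negP: Mu; have fI : injective (mulmx M : 'M['Z_(p ^ s)]_m -> 'M['Z_(p ^ s)]_m).
  move=> B C e; apply/eqP; rewrite -subr_eq0; apply/eqP/matrixP => i j.
  have := h (col j (B - C)).
  have -> : M *m col j (B - C) = 0.
    by rewrite colE mulmxA mulmxBr e subrr mul0mx.
  by rewrite eqxx andbT => /negbT; rewrite negbK => /eqP/matrixP/(_ i 0); rewrite !mxE.
have [B _ MB] := injF_bij fI.
by have /mulmx1_unit[] := MB 1%:M.
Qed.

(** A non-invertible matrix kills at least [p - 1] columns of order [p]. There are at most [p ^ m]
    such columns, each killed by at most a fraction [1 / p ^ m] of all matrices. *)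
Lemma card_nonunit (p s m : nat) : prime p -> (0 < s)%N ->
  (#|[pred M : 'M['Z_(p ^ s)]_m | M \notin unitmx]| * p.-1 <= #|{: 'M['Z_(p ^ s)]_m}|)%N.
Proof.
move=> pp s0; set W := #|{: 'M['Z_(p ^ s)]_m}|.
pose T (x : 'cV['Z_(p ^ s)]_m) := x *+ p ^ 1 == 0.
apply: (@leq_trans (\sum_(M : 'M['Z_(p ^ s)]_m)
                      #|[pred x : 'cV_m | [&& x != 0%R, T x & M *m x == 0%R]]|)%N).
  rewrite -sum_nat_const big_mkcond; apply: leq_sum => M _; case: ifP => // Mu.
  have [x0 x00 Mx0] := nonunit_ker Mu.
  have [b _ /andP[xb xb']] := exists_order pp s0 x00.
  have [j _ cj] : exists2 j, (j <= s * (m * 1))%N & #|[pred x | T x && (M *m x == 0)]| = (p ^ j)%N.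
    apply: (card_zmod_pred pp (card_mx_Zpexp m 1 pp s0)).
      by rewrite /= /T mulmx0 mul0rn eqxx.
    move=> x y /andP[/eqP Tx /eqP Kx] /andP[/eqP Ty /eqP Ky] /=.
    by rewrite /T mulmxDr mulrnDl Kx Ky Tx Ty addr0 eqxx.
  have := cardD1 (0 : 'cV['Z_(p ^ s)]_m) [pred x | T x && (M *m x == 0)].
  rewrite cj inE mulmx0 /T mul0rn eqxx.
  set X := #|_|.
  have X0 : (0 < X)%N.
    (* This multiple of [x0] has order exactly [p]. *)
    apply/card_gt0P; exists (x0 *+ p ^ b); rewrite !inE xb' /= expn1 -mulrnA -expnSr xb /=.
    by rewrite -scaler_nat -scalemxAr Mx0 scaler0.
  rewrite add1n => e; have j0 : (0 < j)%N by case: j cj e => // _ [] e; rewrite -e in X0.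
  rewrite -ltnS prednK ?prime_gt0 // (leq_trans (_ : p <= p ^ j)%N) //.
    by rewrite -{1}[p]expn1 leq_exp2l // prime_gt1.
  rewrite e ltnS; apply: subset_leq_card; apply/fintype.subsetP => x; rewrite !inE.
  by case/and3P => xn0 Tx Kx; apply/and3P.
rewrite -(@leq_pmul2r (p ^ (1 * m))) ?expn_gt0 ?prime_gt0 //.
apply: (@leq_trans ((\sum_(x : 'cV['Z_(p ^ s)]_m | T x && (x != 0%R))
                        #|[pred M : 'M['Z_(p ^ s)]_m | M *m x == 0%R]|)
                    * p ^ (1 * m))%N).
  rewrite leq_mul2r; apply/orP; right.
  under eq_bigr do rewrite -sum1_card.
  rewrite (exchange_big_dep (fun x => T x && (x != 0))) /=; last first.
    by move=> M x _ /and3P[-> ->].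
  apply: leq_sum => x /andP[Tx x0]; rewrite -sum1_card.
  by apply/eq_leq/eq_bigl => M; rewrite !inE x0 Tx.
rewrite big_distrl /= [leqRHS]mulnC.
apply: leq_trans (leq_mul (card_torsion_cV 1 m pp s0) (leqnn _)).
rewrite -sum_nat_const big_mkcond [leqRHS]big_mkcond /=; apply: leq_sum => x _.
rewrite !inE -/(T x); case: (T x) => //=; case: ifP => // x0.
by apply: (@card_kill1 _ _ 0); rewrite // expn0 mulr1n.
Qed.

(** * Lower bound: a family with large kernels, built from Schur complements *)

Lemma subset_card_inj (T V : finType) (D : {pred T}) (Q : {pred V}) (f : T -> V) :
  {in D &, injective f} -> (forall x, x \in D -> f x \in Q) -> (#|D| <= #|Q|)%N.
Proof.
move=> fI fQ; rewrite -(card_in_image fI); apply: subset_leq_card.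
by apply/fintype.subsetP => v /fintype.imageP[x xD ->]; exact: fQ.
Qed.

Lemma mulp_nat_inj (p s k l : nat) : prime p -> (0 < s)%N ->
  (p * k)%:R = (p * l)%:R :> 'Z_(p ^ s) -> k = l %[mod p ^ s.-1].
Proof.
move=> pp s0 /(congr1 val) /=; rewrite !val_Zp_nat ?gt1_pexp //.
case: s s0 => // s _; rewrite expnS -!muln_modr => /eqP.
by rewrite eqn_pmul2l ?prime_gt0 // => /eqP.
Qed.

Lemma coprime_modn_inj (d u k l : nat) : coprime d u -> (k < d)%N -> (l < d)%N ->
  u * k = u * l %[mod d] -> k = l.
Proof.
move=> du; wlog kl : k l / (k <= l)%N => [hw kd ld e|kd ld /esym/eqP].
  by case/orP: (leq_total k l) => h; [exact: hw|apply/esym; exact: hw].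
rewrite eqn_mod_dvd ?leq_mul // -mulnBr Gauss_dvdr // -eqn_mod_dvd //.
by rewrite !modn_small // => /eqP.
Qed.

(** The matrix [p u [[1, x], [y, x y]]]. *)
Definition rank1_mx (p s u x y : nat) : 'M['Z_(p ^ s)]_2 :=
  (p * u)%:R *: ((\col_i (if i == 0 then 1 else y%:R)) *m
                 (\row_j (if j == 0 then 1 else x%:R))).

Lemma rank1_mxE p s u x y i j : rank1_mx p s u x y i j =
  (p * u)%:R * ((if i == 0 then 1 else y%:R) * (if j == 0 then 1 else x%:R)).
Proof. by rewrite !mxE big_ord1 !mxE. Qed.

(** The corner [p u] determines [u]; as [u] is a unit mod [p ^ s.-1], the off-diagonal entries
    [p u x] and [p u y] then determine [x] and [y]. *)
Lemma rank1_mx_inj (p s u x y u' x' y' : nat) : prime p -> (0 < s)%N ->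
  coprime (p ^ s.-1) u -> (u < p ^ s.-1)%N -> (u' < p ^ s.-1)%N ->
  (x < p ^ s.-1)%N -> (x' < p ^ s.-1)%N -> (y < p ^ s.-1)%N -> (y' < p ^ s.-1)%N ->
  rank1_mx p s u x y = rank1_mx p s u' x' y' -> [/\ u = u', x = x' & y = y'].
Proof.
move=> pp s0 cu ltu ltu' ltx ltx' lty lty' /matrixP e.
have euu : u = u'.
  move: (e 0 0); rewrite !rank1_mxE /= !mulr1.
  by move/(mulp_nat_inj pp s0); rewrite !modn_small.
split=> //; rewrite -euu in e; apply: (coprime_modn_inj cu) => //.
  move: (e 0 1); rewrite !rank1_mxE /= !mul1r -!natrM -!mulnA.
  by move/(mulp_nat_inj pp s0).
move: (e 1 0); rewrite !rank1_mxE /= !mulr1 -!natrM -!mulnA.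
by move/(mulp_nat_inj pp s0).
Qed.

Lemma num_sol_rank1_mx (p s u x y : nat) : prime p -> (0 < s)%N ->
  (p ^ s.+1 <= num_sol (rank1_mx p s u x y))%N.
Proof.
move=> pp s0.
have -> : (p ^ s.+1 = #|{: 'I_p * 'Z_(p ^ s)}|)%N.
  by rewrite card_prod card_ord card_Zpexp // expnS.
(* The row [(1, x)] sends this column to [p ^ s.-1 * w.1], which the factor [p] of the matrix
   kills. *)
pose f (w : 'I_p * 'Z_(p ^ s)) : 'cV['Z_(p ^ s)]_2 :=
  \col_i (if i == 0 then (p ^ s.-1 * w.1)%:R - x%:R * w.2 else w.2).
apply: (@subset_card_inj _ _ _ _ f) => [[k t] [k' t'] _ _|[k t] _].
  move/matrixP => e; move: (e 0 0) (e 1 0); rewrite !mxE /= => e0 et.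
  rewrite et in e0 *; congr (_, _); apply/val_inj => /=; move/addIr/(congr1 val): e0.
  have lt (i : 'I_p) : (p ^ s.-1 * i < p ^ s)%N.
    by rewrite -[X in (_ < p ^ X)%N](prednK s0) expnSr ltn_pmul2l // expn_gt0 prime_gt0.
  rewrite /= !val_Zp_nat ?gt1_pexp // !modn_small // => /eqP.
  by rewrite eqn_pmul2l ?expn_gt0 ?prime_gt0 // => /eqP.
rewrite inE /rank1_mx -scalemxAl -mulmxA.
have -> : (\row_j (if j == 0 then 1 else x%:R)) *m f (k, t) = (p ^ s.-1 * k)%:R%:M.
  apply/matrixP => i j; rewrite !ord1 !mxE /= big_ord_recl big_ord1 !mxE /=.
  by rewrite mul1r mulr1n subrK.
rewrite mul_mx_scalar scalerA -natrM.
have -> : (p * u * (p ^ s.-1 * k) = p ^ s * (u * k))%N.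
  by rewrite -[X in (_ = p ^ X * _)%N](prednK s0) expnS; lia.
by rewrite natrM pchar_Zp ?gt1_pexp // mul0r scale0r.
Qed.

(** For invertible [M], [S] is the Schur complement of [M]. Prescribing it in place of the upper
    left corner gives control of the kernel. *)
Definition schur_mx (R : comUnitRingType) (k m : nat) (M : 'M[R]_m)
    (B : 'M[R]_(k, m)) (C : 'M[R]_(m, k)) (S : 'M[R]_k) : 'M[R]_(k + m) :=
  block_mx (S + B *m invmx M *m C) B C M.

Lemma schur_mx_inj (R : comUnitRingType) (k m : nat) M B C S M' B' C' S' :
  @schur_mx R k m M B C S = schur_mx M' B' C' S' -> [/\ M = M', B = B', C = C' & S = S'].
Proof. by move/eq_block_mx => [+ eB eC eM]; rewrite eB eC eM => /addIr ->. Qed.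

Lemma num_sol_schur_mx (q k m : nat) (M : 'M['Z_q]_m) B C (S : 'M['Z_q]_k) :
  M \in unitmx -> (num_sol S <= num_sol (schur_mx M B C S))%N.
Proof.
move=> Mu; apply: (@subset_card_inj _ _ _ _ (fun z => col_mx z (- (invmx M *m (C *m z))))).
  by move=> z z' _ _ /eq_col_mx[].
move=> z; rewrite !inE => /eqP Sz; rewrite /schur_mx mul_block_col mulmxDl Sz add0r.
rewrite !mulmxN !mulmxA mulmxV // mul1mx !subrr.
by apply/eqP/matrixP => i j; rewrite !mxE; case: splitP => ? _; rewrite mxE.
Qed.

(** Distinct parameters give distinct matrices. For [s = 1] the modulus [p ^ s.-1] is 1, and the
    only Schur complement used is the zero matrix. *)
Lemma card_num_sol_gt_ge_unit (p s m : nat) : prime p -> (0 < s)%N ->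
  (#|[pred M : 'M['Z_(p ^ s)]_m | M \in unitmx]| * p ^ (4 * s * m)
     * (totient (p ^ s.-1) * p ^ s.-1 * p ^ s.-1)
   <= #|[pred A : 'M['Z_(p ^ s)]_(2 + m) | (p ^ s < num_sol A)%N]|)%N.
Proof.
move=> pp s0; set q := (p ^ s.-1)%N.
have -> : (p ^ (4 * s * m) = #|{: 'M['Z_(p ^ s)]_(2, m)}| * #|{: 'M['Z_(p ^ s)]_(m, 2)}|)%N.
  by rewrite !card_mx_Zpexp // -expnD; congr (_ ^ _)%N; lia.
have -> : totient q = #|[pred u : 'I_q | coprime q u]|.
  rewrite totient_count_coprime big_mkord -sum1_card [RHS]big_mkcond.
  by apply: eq_bigr => i _; rewrite inE; case: coprime.
pose M22 := ('M['Z_(p ^ s)]_m * 'M['Z_(p ^ s)]_(2, m) * 'M['Z_(p ^ s)]_(m, 2))%type.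
pose f (w : M22 * ('I_q * 'I_q * 'I_q)) :=
  schur_mx w.1.1.1 w.1.1.2 w.1.2 (rank1_mx p s w.2.1.1 w.2.2 w.2.1.2).
pose D := [predX [predX [predX [pred M : 'M['Z_(p ^ s)]_m | M \in unitmx]
      & predT : pred 'M['Z_(p ^ s)]_(2, m)] & predT : pred 'M['Z_(p ^ s)]_(m, 2)]
    & [predX [predX [pred u : 'I_q | coprime q u] & predT : pred 'I_q] & predT : pred 'I_q]].
have -> : (#|[pred M : 'M['Z_(p ^ s)]_m | M \in unitmx]| *
    (#|{: 'M['Z_(p ^ s)]_(2, m)}| * #|{: 'M['Z_(p ^ s)]_(m, 2)}|) *
    (#|[pred u : 'I_q | coprime q u]| * q * q) = #|D|)%N.
  by rewrite !cardX (card_ord q) !mulnA.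
apply: (@subset_card_inj _ _ _ _ f).
  move=> [[[M B] C] [[u y] x]] [[[M' B'] C'] [[u' y'] x']].
  rewrite !inE /= !andbT => /andP[_ cu] _; rewrite /f /= => /schur_mx_inj[-> -> -> e].
  have [//|//|//|//|//|//|eu ex ey] := rank1_mx_inj pp s0 cu _ _ _ _ _ _ e.
  by rewrite (val_inj eu) (val_inj ex) (val_inj ey).
move=> [[[M B] C] [[u y] x]]; rewrite !inE /= !andbT => /andP[Mu _].
apply: leq_trans (num_sol_schur_mx _ _ _ Mu).
by rewrite (leq_trans _ (num_sol_rank1_mx _ _ _ pp s0)) // ltn_exp2l ?prime_gt1.
Qed.

Lemma pexp_totient_ge (p k : nat) : prime p -> (p.-1 * p ^ k <= p * totient (p ^ k))%N.
Proof.
move=> pp; case: k => [|k]; first by rewrite !expn0 !muln1 leq_pred.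
by rewrite totient_pfactor // expnS mulnCA.
Qed.

(** The proportions [(p - 2) / (p - 1)] for invertible blocks and [(p - 1) / p] for units multiply
    to [(p - 2) / p]. With [n = 2 + m] the exponent is [s n^2 - s - 3]. *)
Lemma card_num_sol_gt_ge (p s m : nat) : prime p -> (0 < s)%N ->
  (p.-2 * p ^ (s * m ^ 2 + 4 * s * m + 3 * s.-1) <=
   p * #|[pred A : 'M['Z_(p ^ s)]_(2 + m) | (p ^ s < num_sol A)%N]|)%N.
Proof.
move=> pp s0; have p1 := prime_gt1 pp.
have := card_num_sol_gt_ge_unit m pp s0; set B := #|[pred A | (_ < num_sol A)%N]|.
set U := #|[pred M | _ \in unitmx]| => UB.
have U1 : (p.-2 * p ^ (s * m ^ 2) <= U * p.-1)%N.
  have := card_nonunit m pp s0; rewrite card_mx_Zpexp // -mulnn.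
  have := cardC [pred M : 'M['Z_(p ^ s)]_m | M \in unitmx]; rewrite card_mx_Zpexp // -/U.
  rewrite (@eq_card _ (predC _) [pred M | M \notin unitmx]); last by move=> M; rewrite !inE.
  move: #|[pred M | _ \notin _]| (p ^ (s * (m * m)))%N U {UB} => V W U' <-.
  by case: (p) p1 => [|[|r]] //= _; nia.
have tot := pexp_totient_ge s.-1 pp.
apply: leq_trans (leq_mul (leqnn p) UB).
have -> : (p ^ (s * m ^ 2 + 4 * s * m + 3 * s.-1) =
    p ^ (s * m ^ 2) * p ^ (4 * s * m) * (p ^ s.-1 * p ^ s.-1 * p ^ s.-1))%N.
  by rewrite -!expnD; congr (_ ^ _)%N; lia.
move: (p ^ s.-1)%N (p ^ (4 * s * m))%N (p ^ (s * m ^ 2))%N (totient _) U1 tot => y z w t U1 tot.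
apply: (@leq_trans (U * p.-1 * (z * (y * y * y)))%N); first by rewrite -(mulnA w) mulnA leq_mul2r U1 orbT.
have -> : (U * p.-1 * (z * (y * y * y)) = p.-1 * y * (U * (z * (y * y))))%N by lia.
have -> : (p * (U * z * (t * y * y)) = p * t * (U * (z * (y * y))))%N by lia.
exact: leq_mul.
Qed.

(** * From the two bounds to the error term *)

(** Here [x] is [p], [P] is [p ^ s], and [B] of the [W] matrices have more than [p ^ s] solutions.
    The constant is [4 * 16], from [x^4 - (x - 1)^4 <= 4 x^3] and, as [x >= 2],
    [x^4 <= 16 (x - 1)^4]. *)
Lemma ratio_error_bound (F : realFieldType) (x P B W : F) : 2 <= x -> 0 < P -> 0 < W ->
  B * (P * (x - 1) ^+ 4) <= x * W -> (x - 2) * W <= x * B * (P * x ^+ 3) ->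
  `|(P * x ^+ 3)^-1 - B / W| <= 64 * (P * x ^+ 4)^-1.
Proof.
move=> x2 P0 W0 hi lo.
have x0 : 0 < x by lra.
have y0 : 0 < x - 1 by lra.
have Px4 : 0 < P * x ^+ 4 by rewrite mulr_gt0 ?exprn_gt0.
rewrite ler_norml; apply/andP; split.
  have hB : B / W <= x / (P * (x - 1) ^+ 4).
    rewrite ler_pdivrMr // mulrAC ler_pdivlMr //.
    by rewrite mulr_gt0 ?exprn_gt0.
  suff : x / (P * (x - 1) ^+ 4) - (P * x ^+ 3)^-1 <= 64 * (P * x ^+ 4)^-1 by lra.
  have -> : x / (P * (x - 1) ^+ 4) - (P * x ^+ 3)^-1 =
     (x * (x ^+ 4 - (x - 1) ^+ 4)) / (x - 1) ^+ 4 * (P * x ^+ 4)^-1.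
    by field; rewrite !gt_eqF.
  rewrite ler_pM2r ?invr_gt0 // ler_pdivrMr ?exprn_gt0 //.
  have h : x <= 2 * (x - 1) by lra.
  have h4 : x ^+ 4 <= (2 * (x - 1)) ^+ 4 by rewrite lerXn2r ?nnegrE; lra.
  have h3 : x ^+ 4 - (x - 1) ^+ 4 <= 4 * x ^+ 3.
    have -> : x ^+ 4 - (x - 1) ^+ 4 = 4 * x ^+ 3 - (6 * x ^+ 2 - 4 * x + 1) by ring.
    by nra.
  have : x * (x ^+ 4 - (x - 1) ^+ 4) <= x * (4 * x ^+ 3) by rewrite ler_pM2l.
  by move: h4; rewrite exprMn; lra.
have lo' : (x - 2) / (P * x ^+ 4) <= B / W.
  rewrite ler_pdivlMr // mulrAC ler_pdivrMr //.
  by rewrite (le_trans lo) // exprS; lra.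
have -> : (P * x ^+ 3)^-1 = x * (P * x ^+ 4)^-1 by field; rewrite !gt_eqF.
have : 0 < (P * x ^+ 4)^-1 by rewrite invr_gt0.
by move: lo'; lra.
Qed.

(** The number of solutions is a power of [p], so each matrix on the left is counted by exactly one
    [j]. *)
Lemma card_small_ker (p s n : nat) : prime p -> (0 < s)%N ->
  #|[pred A : 'M['Z_(p ^ s)]_n | (num_sol A <= p ^ s)%N]|
    = (\sum_(0 <= j < s.+1) num_mx_sol n (p ^ s) (p ^ j))%N.
Proof.
move=> pp s0; rewrite big_mkord -sum1_card.
under [RHS]eq_bigr do rewrite /num_mx_sol -sum1_card big_mkcond.
rewrite exchange_big big_mkcond /=; apply: eq_bigr => A _.
have [j cA] := num_sol_pexp A pp s0; have p1 := prime_gt1 pp.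
have inj (i : nat) : (num_sol A == p ^ i)%N = (i == j)%N.
  by rewrite cA eq_sym eqn_exp2l.
rewrite inE cA leq_exp2l //; case: leqP => js.
  rewrite (bigD1 (Ordinal (js : (j < s.+1)%N))) //= big1 => [|i ij].
    by rewrite inE inj eqxx.
  by rewrite inE inj -val_eqE /= in ij *; rewrite (negPf ij).
rewrite big1 // => i _; rewrite inE inj.
by rewrite (ltn_eqF (leq_trans (ltn_ord i) js)).
Qed.

Lemma prob_mxE (R : realType) (n q : nat) (P : pred 'M['Z_q]_n) :
  prob_mx R P = #|P|%:R / #|'Z_q|%:R ^+ (n * n).
Proof.
rewrite /prob_mx (eq_bigr (fun=> (#|'Z_q|%:R ^+ (n * n))^-1)) => [|A _].
  by rewrite sumr_const mulr_natl.
rewrite /entries_law /unif_mass !prodr_const.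
have -> : #|(xpredT : pred 'I_n)| = n by rewrite cardT size_enum_ord.
by rewrite -exprM exprVn.
Qed.

Lemma small_ker_ratio (R : realType) (n s p : nat) : (2 <= n)%N -> (0 < s)%N -> prime p ->
  `|#|[pred A : 'M['Z_(p ^ s)]_n | (num_sol A <= p ^ s)%N]|%:R / p%:R ^+ (s * n ^ 2)
    - (1 - p%:R ^- (s + 3)) : R| <= 64 * p%:R ^- (s + 4).
Proof.
case: n => [|[|m]] // _ s0 pp.
set G := #|_|; pose B := #|[pred A : 'M['Z_(p ^ s)]_(2 + m) | (p ^ s < num_sol A)%N]|.
have p0 : (0 < p)%N by rewrite prime_gt0.
have pr0 : 0 < p%:R :> R by rewrite ltr0n.
set W := p%:R ^+ _.
have W0 : 0 < W by rewrite exprn_gt0.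
have GBW : G%:R + B%:R = W.
  have := cardC [pred A : 'M['Z_(p ^ s)]_m.+2 | (num_sol A <= p ^ s)%N].
  rewrite card_mx_Zpexp // -/G mulnn (@eq_card _ (predC _)
    [pred A : 'M['Z_(p ^ s)]_(2 + m) | (p ^ s < num_sol A)%N]) => [|A].
    by move=> /(congr1 (fun k => k%:R : R)); rewrite natrD natrX.
  by rewrite !inE -ltnNge.
have -> : G%:R / W - (1 - p%:R ^- (s + 3)) = (p%:R ^+ s * p%:R ^+ 3)^-1 - B%:R / W.
  by rewrite -exprD -{1}[G%:R](addrK B%:R) GBW mulrBl divff ?gt_eqF //; ring.
rewrite [in leRHS]exprD; apply: ratio_error_bound; rewrite ?exprn_gt0 //.
- by rewrite (ler_nat R 2) prime_gt1.
- have := card_num_sol_gt_le (2 + m) pp s0; rewrite card_mx_Zpexp // -/B mulnn.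
  by rewrite -(ler_nat R) !natrM !natrX -(natrB R p0) subn1.
have := card_num_sol_gt_ge m pp s0; rewrite -/B -(ler_nat R) !natrM natrX.
rewrite -[p.-2]subn2 natrB ?prime_gt1 //.
(* Multiplying by [p ^ (s + 3)] completes the exponent to that of [W]. *)
rewrite -(@ler_pM2r _ (p%:R ^+ s * p%:R ^+ 3)) ?mulr_gt0 ?exprn_gt0 //.
rewrite -mulrA -!exprD; congr (_ * _ ^+ _ <= _); by lia.
Qed.

Theorem theorem6p8 (R : realType) (n s : nat) (hn : (2 <= n)%N) (hs : (1 <= s)%N) :
  [/\ forall p : nat, prime p ->
        #|[pred A : 'M['Z_(p ^ s)]_n | (num_sol A <= p ^ s)%N]|
          = (\sum_(0 <= j < s.+1) num_mx_sol n (p ^ s) (p ^ j))%N,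
      exists2 e : nat -> R,
        e =O_primes_oo (fun p => p%:R ^- (s + 4) : R) &
        forall p : nat, prime p ->
          (\sum_(0 <= j < s.+1) num_mx_sol n (p ^ s) (p ^ j))%N%:R
            = p%:R ^+ (s * n ^ 2) * (1 - p%:R ^- (s + 3) + e p)
    & exists2 e : nat -> R,
        e =O_primes_oo (fun p => p%:R ^- (s + 4) : R) &
        forall p : nat, prime p ->
          prob_mx R (fun A : 'M['Z_(p ^ s)]_n => (num_sol A <= p ^ s)%N)
            = 1 - p%:R ^- (s + 3) + e p].
Proof.
(* Taking the exact deviation makes both expansions identities, so only its size remains to be
   bounded; one [e] serves the count and the probability. *)
pose e (p : nat) : R :=
  #|[pred A : 'M['Z_(p ^ s)]_n | (num_sol A <= p ^ s)%N]|%:R / p%:R ^+ (s * n ^ 2)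
    - (1 - p%:R ^- (s + 3)).
have eO : e =O_primes_oo (fun p => p%:R ^- (s + 4) : R).
  apply/eqO_exP; exists 64; first by [].
  rewrite /primes_oo near_withinE; apply: nearW => p pp.
  rewrite [X in _ <= _ * X]ger0_norm ?invr_ge0 ?exprn_ge0 //.
  exact: small_ker_ratio.
have p0 (p : nat) : prime p -> p%:R != 0 :> R by move=> pp; rewrite pnatr_eq0 -lt0n prime_gt0.
split; first by move=> p pp; exact: card_small_ker.
- exists e => // p pp; rewrite /e addrC subrK mulrC divfK ?expf_neq0 ?p0 //.
  by rewrite card_small_ker.
- by exists e => // p pp; rewrite /e addrC subrK prob_mxE card_Zpexp // natrX -exprM mulnn.
Qed.
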